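(* Let $A\in\mathbb{C}^{n\times n}$ and set $S=\frac12(A+A^\top)=S_1+S_2\mathbf{i}$, where $S_1,S_2$ are real symmetric $n\times n$ matrices. Let $$\hat S_1=\begin{bmatrix}S_1&-S_2\\-S_2&-S_1\end{bmatrix},\qquad \hat S_2=\begin{bmatrix}S_2&S_1\\S_1&-S_2\end{bmatrix},$$ which are real symmetric matrices of order $2n$. Then: (a) The set $\mathrm{co}(\mathbf{W}_\pi(A))$ is a compact convex set in $\mathbb{C}$. For every $\theta\in\mathbb{R}$, the supporting lines of $\mathrm{co}(\mathbf{W}_\pi(A))$ of the form $\Re(e^{-\theta\mathbf{i}}z)=\mathrm{const}$ are $$\Re(e^{-\theta\mathbf{i}}z)=\lambda_{\min}(\cos\theta\,\hat S_1+\sin\theta\,\hat S_2),\qquad \Re(e^{-\theta\mathbf{i}}z)=\lambda_{\max}(\cos\theta\,\hat S_1+\sin\theta\,\hat S_2).$$ That is, every $z=x+\mathbf{i}y\in\mathrm{co}(\mathbf{W}_\pi(A))$ ($x,y\in\mathbb{R}$) satisfies $$\lambda_{\min}(\cos\theta\,\hat S_1+\sin\theta\,\hat S_2)\le x\cos\theta+y\sin\theta\le\lambda_{\max}(\cos\theta\,\hat S_1+\sin\theta\,\hat S_2),$$ and both inequalities are sharp (each is attained for some $z\in\mathrm{co}(\mathbf{W}_\pi(A))$). (b) $$r_\pi(A)=\max\{\lambda_{\max}(t_1\hat S_1+t_2\hat S_2):(t_1,t_2)^\top\in\mathbb{R}^2,\ t_1^2+t_2^2\le1\}=\max\{\lambda_{\max}(t_1\hat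 S_1+t_2\hat S_2):(t_1,t_2)^\top\in\mathbb{R}^2,\ t_1^2+t_2^2=1\}.$$
   Context: $\mathbf{i}$ is the imaginary unit of $\mathbb{C}$. For $A\in\mathbb{C}^{n\times n}$ the pseudo-numerical range is $\mathbf{W}_\pi(A)=\{\mathbf{x}^\top A\mathbf{x}:\mathbf{x}\in\mathbb{C}^n,\|\mathbf{x}\|=1\}$ (transpose, not conjugate transpose) and the pseudo-numerical radius is $r_\pi(A)=\max\{|\mathbf{x}^\top A\mathbf{x}|:\mathbf{x}\in\mathbb{C}^n,\|\mathbf{x}\|=1\}$, where $\|\mathbf{x}\|=\sqrt{\mathbf{x}^*\mathbf{x}}$. $\mathrm{co}(\cdot)$ is the convex hull in $\mathbb{C}\cong\mathbb{R}^2$; $\lambda_{\max},\lambda_{\min}$ are the largest and smallest eigenvalues of a real symmetric matrix. *)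

(* Defs.v *)
From HB Require Import structures.
From mathcomp Require Import all_boot all_order all_algebra.
From mathcomp Require Import all_classical all_reals all_analysis.
From mathcomp Require Export complex.

Set Implicit Arguments.
Unset Strict Implicit.
Unset Printing Implicit Defensive.

Import Order.TTheory GRing.Theory Num.Theory.
Import numFieldNormedType.Exports.

Local Open Scope classical_set_scope.
Local Open Scope sesquilinear_scope.
Local Open Scope ring_scope.

Section Extrema.
Variable R : realType.
Implicit Types (X : set R) (m : R).

Definition is_max X m := X m /\ ubound X m.
Definition is_min X m := X m /\ lbound X m.

(* The default value 0 is only used when X has no greatest (least) element. *)
Definition maximum X : R := xget 0 (is_max X).
Definition minimum X : R := xget 0 (is_min X).

Lemma maximumE X m : is_max X m -> maximum X = m.
Proof.
move=> mX; apply: xget_unique => // p pX.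
by apply/le_anti; rewrite (proj2 mX _ (proj1 pX)) (proj2 pX _ (proj1 mX)).
Qed.

Lemma minimumE X m : is_min X m -> minimum X = m.
Proof.
move=> mX; apply: xget_unique => // p pX.
by apply/le_anti; rewrite (proj2 pX _ (proj1 mX)) (proj2 mX _ (proj1 pX)).
Qed.

Definition lambda_max n (M : 'M[R]_n) : R :=
  maximum [set l | eigenvalue M l].
Definition lambda_min n (M : 'M[R]_n) : R :=
  minimum [set l | eigenvalue M l].

End Extrema.

Section PseudoNumericalRange.
Variable R : realType.

Definition vnorm n (x : 'cV[R[i]]_n) : R[i] := sqrtC ((x^t* *m x) 0 0).

(* x^T A x, with the plain transpose. *)
Definition qform n (A : 'M[R[i]]_n) (x : 'cV[R[i]]_n) : R[i] :=
  (x^T *m A *m x) 0 0.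

Definition pseudo_range n (A : 'M[R[i]]_n) : set R[i] :=
  [set qform A x | x in [set x | vnorm x = 1]].

(* normc is the modulus of a complex number as an element of R. *)
Definition pseudo_radius n (A : 'M[R[i]]_n) : R :=
  maximum
    [set ComplexField.Normc.normc (qform A x) | x in [set x | vnorm x = 1]].

(* Rcomplex R is R[i] seen as an R-vector space: convex combinations are taken
   with real coefficients. *)
Definition cconvex (K : set R[i]) : Prop := @convex_set R (Rcomplex R) K.

Definition chull (W : set R[i]) : set R[i] := smallest cconvex W.

(* Compactness for the topology of the norm of R[i]. *)
Definition ccompact (K : set R[i]) : Prop :=
  compact (K : set (R[i] : numFieldType)).

Definition cis (t : R) : R[i] := Complex (cos t) (sin t).

(* The line of equation Re (e^(- theta i) z) = c. *)
Definition re_line (theta c : R) : set R[i] :=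
  [set z | complex.Re (cis (- theta) * z) = c].

(* The line meets K and K lies in one of the two closed half-planes it
   bounds. *)
Definition supporting_re_line (K : set R[i]) (theta c : R) : Prop :=
  K `&` re_line theta c !=set0 /\
  ((forall z, K z -> complex.Re (cis (- theta) * z) <= c) \/
   (forall z, K z -> c <= complex.Re (cis (- theta) * z))).

Definition hat1 n (S1 S2 : 'M[R]_n) : 'M[R]_(n + n) :=
  block_mx S1 (- S2) (- S2) (- S1).
Definition hat2 n (S1 S2 : 'M[R]_n) : 'M[R]_(n + n) :=
  block_mx S2 S1 S1 (- S2).

End PseudoNumericalRange.

(* Main.v *)
Require Import Defs.
From HB Require Import structures.
From mathcomp Require Import all_boot all_order all_algebra.
From mathcomp Require Import all_classical all_reals all_analysis.
From mathcomp Require Import complex.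
From mathcomp Require Import ring lra.

Set Implicit Arguments.
Unset Strict Implicit.
Unset Printing Implicit Defensive.

Import Order.TTheory GRing.Theory Num.Theory.
Import numFieldNormedType.Exports.

Local Open Scope classical_set_scope.
Local Open Scope ring_scope.

(** Replacing a unit vector x by c x with |c| = 1 multiplies x^T A x by c^2,
    and every complex number of modulus one is such a square.  The
    pseudo-numerical range is therefore invariant under all rotations about
    the origin, so it contains the whole circle of radius r = r_pi(A) and lies
    in the closed disk of radius r: its convex hull is that disk.

    Everything in the theorem is then a statement about a disk, once the
    extreme eigenvalues of t1 H1 + t2 H2 (H1 and H2 being the two hat
    matrices) are known to be |t| r and - |t| r.  This comes from the real
    form of the problem: if w in R^(2n) is made of the real and imaginary parts
    of x, then |w| = |x| and x^T A x = w H1 w^T + i w H2 w^T ([qform_hat]).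
    Hence w (t1 H1 + t2 H2) w^T is the real part of conj(t1 + i t2) x^T A x,
    which on unit vectors ranges within [- |t| r, |t| r] and, by rotation
    invariance, reaches both ends ([pencil_extrema]).

    Two standard facts support this.  The Rayleigh principle ([rayleigh_max],
    [rayleigh_min]) identifies the extreme values of the quadratic form of a
    symmetric matrix on the unit sphere with its extreme eigenvalues.
    Compactness of the real unit sphere gives a maximizing vector, whence r is
    attained ([qform_extremal]); it also gives compactness of the disk, which
    is a projection of the unit sphere of R^3 ([disk_ccompact]). *)

(** * Real quadratic forms and the Rayleigh principle *)

Section RealQuadraticForms.
Variables (R : realType) (m : nat).
Implicit Types (M : 'M[R]_m) (v w : 'rV[R]_m).

Definition qf M w : R := (w *m M *m w^T) 0 0.

Definition unit_sphere : set 'rV[R]_m := [set w | qf 1%:M w = 1].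

Lemma qf1E w : qf 1%:M w = \sum_j w 0 j ^+ 2.
Proof. by rewrite /qf mulmx1 mxE; apply: eq_bigr => j _; rewrite mxE. Qed.

Lemma qf1_ge0 w : 0 <= qf 1%:M w.
Proof. by rewrite qf1E sumr_ge0 // => j _; apply: sqr_ge0. Qed.

Lemma qf1_eq0 w : qf 1%:M w = 0 -> w = 0.
Proof.
rewrite qf1E => /eqP; rewrite psumr_eq0 => [/allP w0|j _]; last exact: sqr_ge0.
apply/rowP => j; rewrite mxE; apply/eqP.
by have := w0 j (mem_index_enum j); rewrite expf_eq0.
Qed.

Lemma qfZv M a w : qf M (a *: w) = a ^+ 2 * qf M w.
Proof. by rewrite /qf linearZ /= -!scalemxAl -scalemxAr !mxE mulrA. Qed.

Lemma qfD M N w : qf (M + N) w = qf M w + qf N w.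
Proof. by rewrite /qf mulmxDr mulmxDl mxE. Qed.

Lemma qfZ a M w : qf (a *: M) w = a * qf M w.
Proof. by rewrite /qf -scalemxAr -scalemxAl mxE. Qed.

Lemma qfN M w : qf (- M) w = - qf M w.
Proof. by rewrite /qf mulmxN mulNmx mxE. Qed.

Lemma qf_normalize w : w != 0 ->
  unit_sphere ((Num.sqrt (qf 1%:M w))^-1 *: w).
Proof.
move=> w0; rewrite /unit_sphere /= qfZv exprVn sqr_sqrtr ?qf1_ge0 // mulVf //.
by apply: contra_neq w0 => /qf1_eq0.
Qed.

Lemma qf_continuous M : continuous (qf M).
Proof.
suff -> : qf M = fun w => \sum_j (\sum_i w 0 i * M i j) * w 0 j.
  apply: continuous_big => [|j _]; first exact: add_continuous.
  move=> w; apply: continuousM; last exact: coord_continuous.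
  move: w; apply: continuous_big => [|i _]; first exact: add_continuous.
  by move=> w; apply: continuousM;
    [exact: coord_continuous | exact: cst_continuous].
apply/funext => w; rewrite /qf mxE; apply: eq_bigr => j _.
by rewrite !mxE.
Qed.

Lemma unit_sphere_coord w j : unit_sphere w -> `|w 0 j| <= 1.
Proof.
rewrite /unit_sphere /= qf1E (bigD1 j) //= => w1.
rewrite -(@ler_pXn2r _ 2) ?nnegrE // expr1n real_normK ?num_real //.
by rewrite -w1 lerDl sumr_ge0 // => i _; apply: sqr_ge0.
Qed.

Lemma unit_sphere_compact : compact unit_sphere.
Proof.
apply: bounded_closed_compact.
  exists 1; split => // M M1 w /= w1; rewrite /Num.norm /= mx_normrE.
  apply/bigmax_leP; split => [|[i j] _]; first by lra.
  by rewrite ord1 (le_trans _ (ltW M1)) //= unit_sphere_coord.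
apply: (@preimage_closed _ _ (qf 1%:M) [set x | x = 1]); last exact: closed_eq.
by move=> w _; apply: qf_continuous.
Qed.

(** A nonnegative form vanishing at w has a minimum there, so the linear
    part 2 t w M h^T of its expansion along any direction h must vanish; for
    h = w M this linear part is 2 t |w M|^2. *)
Lemma psd_isotropic_kernel M w : M^T = M -> (forall v, 0 <= qf M v) ->
  qf M w = 0 -> w *m M = 0.
Proof.
move=> Msym Mpsd w0; set h := w *m M; apply: qf1_eq0.
have expand t : qf M (w + t *: h) = 2 * t * qf 1%:M h + t ^+ 2 * qf M h.
  have addE (A B : 'M[R]_1) : (A + B) 0 0 = A 0 0 + B 0 0 by rewrite mxE.
  have wMh : (w *m M *m (t *: h)^T) 0 0 = t * qf 1%:M h.
    by rewrite linearZ /= -scalemxAr mxE /qf mulmx1.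
  have hMw : (t *: h *m M *m w^T) 0 0 = t * qf 1%:M h.
    rewrite -!scalemxAl -mulmxA -[X in X *m w^T]Msym -trmx_mul mxE.
    by rewrite /qf mulmx1.
  rewrite {1}/qf linearD /= !mulmxDl !mulmxDr.
  rewrite !addE wMh hMw.
  rewrite -[(w *m M *m w^T) 0 0]/(qf M w) w0.
  rewrite -[(t *: h *m M *m (t *: h)^T) 0 0]/(qf M (t *: h)) qfZv.
  by ring.
have h0 := qf1_ge0 h; have hM := Mpsd h.
apply/eqP; rewrite eq_le h0 andbT leNgt; apply/negP => h_gt0.
(* The step - a / (b + 1), where a = |h|^2 and b = h M h^T, is close to the
   minimizer - a / b of the parabola 2 a t + b t^2 and is defined also when
   b = 0; at this step the parabola is negative. *)
have := Mpsd (w + (- qf 1%:M h / (qf M h + 1)) *: h); rewrite expand.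
set a := qf 1%:M h in h0 h_gt0 *; set b := qf M h in hM *.
suff -> : 2 * (- a / (b + 1)) * a + (- a / (b + 1)) ^+ 2 * b =
  - (a / (b + 1)) ^+ 2 * (b + 2).
  rewrite leNgt => /negP; apply; rewrite mulNr oppr_lt0 mulr_gt0 ?exprn_gt0 //.
    by rewrite divr_gt0 // ltr_wpDl.
  by rewrite ltr_wpDl.
by field; rewrite gt_eqF // ltr_wpDl.
Qed.

Lemma eigen_sphere M l : eigenvalue M l ->
  exists2 w, unit_sphere w & qf M w = l.
Proof.
move=> /eigenvalueP[v vM v0].
have v1 := qf_normalize v0; exists ((Num.sqrt (qf 1%:M v))^-1 *: v) => //.
move: v1; rewrite /unit_sphere /= !qfZv => v1.
have -> : qf M v = l * qf 1%:M v.
  by rewrite /qf vM mulmx1 -scalemxAl mxE.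
by rewrite mulrCA v1 mulr1.
Qed.

(** The form of r I - M is nonnegative by homogeneity and vanishes at the
    maximizer, which [psd_isotropic_kernel] then puts in its kernel. *)
Lemma maximizer_eigenvector M r w : M^T = M ->
    (forall v, unit_sphere v -> qf M v <= r) ->
    unit_sphere w -> qf M w = r ->
  eigenvalue M r.
Proof.
move=> Msym Mr w1 Mw.
have NE v : qf (r%:M - M) v = r * qf 1%:M v - qf M v.
  by rewrite qfD qfN -[r%:M]scalemx1 qfZ.
have N_psd v : 0 <= qf (r%:M - M) v.
  have [->|v0] := eqVneq v 0; first by rewrite /qf !mul0mx mxE.
  have := Mr _ (qf_normalize v0); rewrite NE qfZv exprVn sqr_sqrtr ?qf1_ge0 //.
  have vpos : 0 < qf 1%:M v.
    by rewrite lt_def qf1_ge0 andbT; apply: contra_neq v0 => /qf1_eq0.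
  by rewrite mulrC ler_pdivrMr // subr_ge0.
have wN : w *m (r%:M - M) = 0.
  apply: psd_isotropic_kernel => //; last first.
    by rewrite NE Mw [qf 1%:M w]w1 mulr1 subrr.
  by rewrite linearB /= tr_scalar_mx Msym.
apply/eigenvalueP; exists w.
  by apply/esym/eqP; rewrite -mul_mx_scalar -subr_eq0 -mulmxBr wN.
apply/eqP => w0; move: w1; rewrite /unit_sphere /= w0 /qf !mul0mx mxE.
by move/esym/eqP; rewrite oner_eq0.
Qed.

Lemma rayleigh_max M r w : M^T = M ->
    (forall v, unit_sphere v -> qf M v <= r) ->
    unit_sphere w -> qf M w = r ->
  lambda_max M = r.
Proof.
move=> Msym Mr w1 Mw; apply: maximumE.
split => /=; first exact: maximizer_eigenvector Mw.
by move=> l /eigen_sphere[v v1 <-]; apply: Mr.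
Qed.

Lemma rayleigh_min M r w : M^T = M ->
    (forall v, unit_sphere v -> r <= qf M v) ->
    unit_sphere w -> qf M w = r ->
  lambda_min M = r.
Proof.
move=> Msym Mr w1 Mw; apply: minimumE.
split => /=; last by move=> l /eigen_sphere[v v1 <-]; apply: Mr.
have /eigenvalueP[v vM v0] : eigenvalue (- M) (- r).
  apply: (@maximizer_eigenvector _ _ w) => //; first by rewrite linearN /= Msym.
    by move=> v v1; rewrite qfN lerN2; apply: Mr.
  by rewrite qfN Mw.
apply/eigenvalueP; exists v => //; apply: oppr_inj.
by rewrite -mulmxN vM scaleNr.
Qed.

End RealQuadraticForms.

(** * Closed disks of the complex plane *)

Section Disks.
Variable R : realType.
Implicit Types (z : R[i]) (r : R).

Local Notation normc := ComplexField.Normc.normc.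

Lemma normc_ge0 z : 0 <= normc z.
Proof. by case: z => a b; apply: sqrtr_ge0. Qed.

Lemma normc_real r : normc r%:C%C = `|r|.
Proof. by rewrite /= expr0n addr0 sqrtr_sqr. Qed.

Lemma norm_Re_le_normc z : `|complex.Re z| <= normc z.
Proof.
by case: z => a b /=; rewrite -sqrtr_sqr ler_wsqrtr // lerDl sqr_ge0.
Qed.

(** The polar form of z with its phase written as a square: c is the factor by
    which a vector must be scaled for its quadratic value to be rotated by
    the phase of z. *)
Lemma phase_sqrt z : exists2 c, normc c = 1 & z = c ^+ 2 * (normc z)%:C%C.
Proof.
have [->|z0] := eqVneq z 0.
  exists 1; first exact: ComplexField.Normc.normc1.
  by rewrite ComplexField.Normc.normc0 mulr0.
have nz0 : normc z != 0.
  by apply: contra_neq z0 => /ComplexField.Normc.eq0_normc.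
have nzC0 : (normc z)%:C%C != 0 by rewrite fmorph_eq0.
exists (sqrtc (z / (normc z)%:C%C)); last by rewrite sqr_sqrtc divfK.
apply/eqP; rewrite -sqrp_eq1 ?normc_ge0 // expr2 -ComplexField.Normc.normcM.
rewrite -expr2 sqr_sqrtc ComplexField.Normc.normcM ComplexField.Normc.normcV.
by rewrite normc_real ger0_norm ?normc_ge0 // mulfV.
Qed.

Definition disk r : set R[i] := [set z | normc z <= r].

Lemma Rcomplex_scaleE (a : R) (z : Rcomplex R) : a *: z = a%:C%C * z :> R[i].
Proof. by case: z => x y; simpc. Qed.

Lemma disk_cconvex r : cconvex (disk r).
Proof.
move=> x y l; rewrite !inE /disk /= => xr yr.
apply: le_trans (le_normcD _ _) _.
rewrite !Rcomplex_scaleE !ComplexField.Normc.normcM !normc_real.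
have l0 : 0 <= l%:num by []. have l1 : l%:num <= 1 by [].
rewrite ger0_norm // ger0_norm ?subr_ge0 //.
have -> : r = l%:num * r + (1 - l%:num) * r by ring.
by rewrite lerD // ler_wpM2l // subr_ge0.
Qed.

(** Each point of the disk lies on a diameter, whose two ends are on the
    circle, so that the circle alone has the disk as its convex hull. *)
Lemma chull_of_circle (W : set R[i]) r : 0 <= r -> W `<=` disk r ->
  (forall z, normc z = r -> W z) -> chull W = disk r.
Proof.
move=> r0 Wdisk circleW; apply/seteqP; split.
  by apply: smallest_sub => //; apply: disk_cconvex.
move=> z zr A [Aconv WA].
have [c c1 zE] := phase_sqrt z.
set P := c ^+ 2 * r%:C%C.
have nP : normc P = r.
  by rewrite !ComplexField.Normc.normcM c1 !mul1r normc_real ger0_norm.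
have AP : A P by apply/WA/circleW.
have AN : A (- P) by apply/WA/circleW; rewrite normcN.
(* z = |z| c^2 is the point t P + (1 - t) (- P) for 2 t - 1 = |z| / r; when
   r = 0 this reads t = 1 / 2 and P = z = 0. *)
have t01 : 0 <= (1 + normc z / r) / 2 <= 1.
  have : 0 <= normc z / r <= 1.
    rewrite divr_ge0 ?normc_ge0 //=.
    have [->|rn0] := eqVneq r 0; first by rewrite invr0 mulr0.
    by rewrite ler_pdivrMr ?mul1r // lt_def rn0.
  by lra.
case/andP: t01 => t0 t1.
have := Aconv P (- P) (Itv01 t0 t1); rewrite !inE => /(_ AP AN).
set t := (1 + normc z / r) / 2.
congr (A _); transitivity (t%:C%C * P + (1 - t)%:C%C * - P).
  by rewrite -!Rcomplex_scaleE.
have -> : t%:C%C * P + (1 - t)%:C%C * - P = (2 * t - 1)%:C%C * P.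
  by rewrite mulrN -mulrBl -rmorphB; congr (_%:C%C * _); ring.
rewrite [RHS]zE /P mulrCA -rmorphM; congr (_ * _%:C%C).
have [r00|rn0] := eqVneq r 0; last by rewrite /t; field.
by apply/eqP; rewrite r00 mulr0 eq_le normc_ge0 /= -r00.
Qed.

Lemma real_complex_continuous :
  continuous (real_complex R : R -> (R[i] : numFieldType)).
Proof.
move=> x; apply/cvgrPdist_lt => e e0.
have eE : e = (complex.Re e)%:C%C by rewrite RRe_real // gtr0_real.
have {}e0 : 0 < complex.Re e by rewrite -ltcR -eE.
near=> y; rewrite eE -rmorphB normc_def /= expr0n addr0 sqrtr_sqr ltcR.
by near: y; apply: cvgr_dist_lt.
Unshelve. all: by end_near. Qed.

(** The disk is the image of the compact unit sphere of R^3 under r times the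
    projection onto the first two coordinates. *)
Lemma disk_ccompact r : 0 <= r -> ccompact (disk r).
Proof.
move=> r0.
pose f (w : 'rV[R]_3) : (R[i] : numFieldType) :=
  r%:C%C * ((w 0 ord0)%:C%C + 'i%C * (w 0 (lift ord0 ord0))%:C%C).
have -> : disk r = f @` @unit_sphere R 3.
  have fE w : f w = Complex (r * w 0 ord0) (r * w 0 (lift ord0 ord0)).
    by rewrite /f; simpc.
  apply/seteqP; split => [[x y] /= xyr|_ [w w1 <-]]; last first.
    rewrite /disk fE /= !exprMn -mulrDr sqrtrM ?sqr_ge0 // sqrtr_sqr.
    rewrite ger0_norm // ler_piMr // -sqrtr1 ler_wsqrtr //.
    move: w1; rewrite /unit_sphere /= qf1E !big_ord_recl big_ord0 addr0 => <-.
    by rewrite addrA lerDl sqr_ge0.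
  have xy2 : x ^+ 2 + y ^+ 2 <= r ^+ 2.
    by rewrite -[leRHS]ger0_norm ?sqr_ge0 // -ler_sqrt ?sqr_ge0 //
       ger0_norm ?sqr_ge0 // sqrtr_sqr ger0_norm.
  have [r00|rn0] := eqVneq r 0.
    exists (delta_mx 0 0).
      rewrite /unit_sphere /= qf1E !big_ord_recl big_ord0 !mxE /=.
      by rewrite expr1n expr0n !addr0.
    move: xy2; rewrite fE r00 !mul0r expr0n /= => xy2.
    have /eqP : x ^+ 2 + y ^+ 2 = 0.
      by apply/eqP; rewrite eq_le xy2 addr_ge0 ?sqr_ge0.
    by rewrite paddr_eq0 ?sqr_ge0 // !expf_eq0 => /andP[/eqP -> /eqP ->].
  pose h := 1 - (x ^+ 2 + y ^+ 2) / r ^+ 2.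
  have h0 : 0 <= h.
    by rewrite subr_ge0 ler_pdivrMr ?mul1r // exprn_gt0 // lt_def rn0.
  exists (\row_j [:: x / r; y / r; Num.sqrt h]`_j).
    rewrite /unit_sphere /= qf1E !big_ord_recl big_ord0 !mxE /= sqr_sqrtr //.
    by rewrite /h; field.
  by rewrite fE !mxE /=; congr (Complex _ _); field.
apply: continuous_compact; last exact: unit_sphere_compact.
apply: continuous_subspaceT => w.
pose K : numFieldType := R[i].
pose coord j (v : 'rV[R]_3) : K := (v 0 j)%:C%C.
have coordC j : {for w, continuous (coord j)}.
  by apply: continuous_comp;
    [exact: coord_continuous | exact: real_complex_continuous].
have cstC (a : K) : {for w, continuous (fun _ : 'rV[R]_3 => a)}.
  exact: cst_continuous.
exact: (@continuousM K _ _ _ w (cstC _)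
         (@continuousD _ K _ _ _ w (coordC _)
           (@continuousM K _ _ _ w (cstC _) (coordC _)))).
Qed.

Lemma normc_cis (t : R) : normc (cis t) = 1.
Proof. by rewrite /= cos2Dsin2 sqrtr1. Qed.

Lemma Re_cisN (t x y : R) :
  complex.Re (cis (- t) * Complex x y) = x * cos t + y * sin t.
Proof. by rewrite /cis /= cosN sinN; ring. Qed.

Lemma disk_directional_bound (t r : R) z :
  disk r z -> - r <= complex.Re (cis (- t) * z) <= r.
Proof.
move=> zr; rewrite -ler_norml; apply: le_trans (norm_Re_le_normc _) _.
by rewrite ComplexField.Normc.normcM normc_cis mul1r.
Qed.

Lemma disk_directional_attained (t r e : R) : `|e| <= r ->
  exists2 z, disk r z & complex.Re (cis (- t) * z) = e.
Proof.
move=> er; exists (cis t * e%:C%C).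
  rewrite -[disk r _]/(is_true (normc (cis t * e%:C%C) <= r)).
  by rewrite ComplexField.Normc.normcM normc_cis mul1r normc_real.
rewrite /cis /= cosN sinN.
transitivity (e * (cos t ^+ 2 + sin t ^+ 2)); first by ring.
by rewrite cos2Dsin2 mulr1.
Qed.

Lemma supporting_disk (t r c : R) : 0 <= r ->
  supporting_re_line (disk r) t c <-> c = - r \/ c = r.
Proof.
move=> r0.
have rr : `|r| <= r by rewrite ger0_norm.
have nr : `|- r| <= r by rewrite normrN.
have [p pr pE] := disk_directional_attained t rr.
have [q qr qE] := disk_directional_attained t nr.
split=> [[[z [zr zc]] side]|cE].
  have /andP[rz zr'] := disk_directional_bound t zr.
  rewrite zc in rz zr'.
  case: side => side.
    by right; apply/le_anti; rewrite zr' -pE side.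
  by left; apply/le_anti; rewrite rz -qE side.
split; first by case: cE => ->; [exists q | exists p].
by case: cE => ->; [right|left] => z /(disk_directional_bound t)/andP[].
Qed.

End Disks.

(** * The pseudo-numerical range as a pair of real quadratic forms *)

Section PseudoRangeAsRealForms.
Variables (R : realType) (n : nat).
Implicit Types (x : 'cV[R[i]]_n) (A : 'M[R[i]]_n) (S : 'M[R]_n).

Local Open Scope sesquilinear_scope.
Local Notation normc := ComplexField.Normc.normc.
Local Notation toC := (map_mx (real_complex R)).

Definition realify x : 'rV[R]_(n + n) :=
  row_mx (\row_j complex.Re (x j 0)) (\row_j complex.Im (x j 0)).

Lemma realify_surj w : exists x, realify x = w.
Proof.
exists (\col_j Complex (lsubmx w 0 j) (rsubmx w 0 j)).
rewrite -[RHS]hsubmxK /realify; congr row_mx.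
  by apply/rowP => j; rewrite !mxE.
by apply/rowP => j; rewrite !mxE.
Qed.

Lemma sqr_vnorm x :
  vnorm x ^+ 2 = (qf 1%:M (realify x))%:C%C.
Proof.
rewrite /vnorm sqrtCK mxE qf1E big_split_ord /= -big_split /= rmorph_sum.
apply: eq_bigr => j _; rewrite /realify row_mxEl row_mxEr !mxE.
by rewrite /= (add_Re2_Im2 (x j 0)) normCK mulrC.
Qed.

Lemma vnorm1P x : vnorm x = 1 <-> unit_sphere (realify x).
Proof.
rewrite /unit_sphere /=; split => [x1|x1].
  by apply: complexI; rewrite -sqr_vnorm x1 expr1n.
by move: (sqr_vnorm x); rewrite /vnorm sqrtCK x1 => ->; rewrite sqrtC1.
Qed.

Lemma vnorm_phase c x : normc c = 1 -> vnorm x = 1 -> vnorm (c *: x) = 1.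
Proof.
move=> c1; rewrite /vnorm => x1.
have cc : c^* * c = 1.
  rewrite mulrC -normCK.
  have -> : `|c| = (normc c)%:C%C by case: (c).
  by rewrite c1 expr1n.
have -> : (c *: x)^t* *m (c *: x) = x^t* *m x.
  apply/matrixP => i j; rewrite !mxE; apply: eq_bigr => k _.
  by rewrite !mxE rmorphM mulrACA cc mul1r.
exact: x1.
Qed.

Lemma qform_phase A c x : qform A (c *: x) = c ^+ 2 * qform A x.
Proof.
by rewrite /qform [(c *: x)^T]linearZ /= -!scalemxAl -scalemxAr scalerA mxE.
Qed.

Lemma qform_sym A x : qform (2^-1 *: (A + A^T)) x = qform A x.
Proof.
have trq : qform A^T x = qform A x.
  rewrite /qform; have -> : x^T *m A^T *m x = (x^T *m A *m x)^T.
    by rewrite !trmx_mul trmxK mulmxA.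
  by rewrite mxE.
have -> : qform (2^-1 *: (A + A^T)) x = 2^-1 * (qform A x + qform A^T x).
  rewrite {1}/qform -scalemxAr -scalemxAl mulmxDr mulmxDl.
  by rewrite mxE [X in _ * X]mxE.
by rewrite trq; field.
Qed.

Lemma mulmx_ReIm (p q r : nat) (B B' : 'M[R]_(p, q)) (C C' : 'M[R]_(q, r)) :
  (toC B + 'i%C *: toC B') *m (toC C + 'i%C *: toC C') =
  toC (B *m C - B' *m C') + 'i%C *: toC (B *m C' + B' *m C).
Proof.
rewrite map_mxB map_mxD !map_mxM mulmxDl !mulmxDr.
rewrite -!scalemxAl -!scalemxAr scalerA -expr2 sqr_i scaleN1r scalerDr.
by rewrite -!addrA; congr (_ + _); rewrite addrA addrC.
Qed.

(** Multiplying out (u + i v) (S1 + i S2) (u + i v)^T, the real and imaginary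
    parts are exactly the block expansions of the forms of the hat matrices at
    (u, v). *)
Lemma qform_hat A S1 S2 x :
  2^-1 *: (A + A^T) = toC S1 + 'i%C *: toC S2 ->
  qform A x =
  Complex (qf (hat1 S1 S2) (realify x)) (qf (hat2 S1 S2) (realify x)).
Proof.
move=> hS; rewrite -qform_sym hS /qform /qf /realify /hat1 /hat2.
set u := \row_j complex.Re _; set v := \row_j complex.Im _.
have -> : x = toC u^T + 'i%C *: toC v^T.
  by apply/colP => j; rewrite !mxE -complexE.
have -> : (toC u^T + 'i%C *: toC v^T)^T = toC u + 'i%C *: toC v.
  by apply/rowP => j; rewrite !mxE.
clearbody u v; rewrite !mulmx_ReIm.
rewrite !mul_row_block !tr_row_mx !mul_row_col.
have entryE (X Y : 'M[R]_1) :
    (toC X + 'i%C *: toC Y) 0 0 = Complex (X 0 0) (Y 0 0).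
  by rewrite [RHS]complexE !mxE.
rewrite entryE; congr Complex; congr (fun_of_matrix _ 0 0).
  by rewrite !mulmxN -opprD mulNmx.
by rewrite mulmxN addrC.
Qed.

End PseudoRangeAsRealForms.

(** * Rotation invariance and its consequences *)

Section ExtremalVector.
Variables (R : realType) (n : nat) (A : 'M[R[i]]_n) (S1 S2 : 'M[R]_n).

Local Notation normc := ComplexField.Normc.normc.
Local Notation toC := (map_mx (real_complex R)).

Hypothesis n_gt0 : (0 < n)%N.
Hypothesis hS : 2^-1 *: (A + A^T) = toC S1 + 'i%C *: toC S2.

(** It is enough to maximize the real part over the sphere: at any unit vector
    the value can be rotated onto the positive real axis without changing its
    modulus, so the maximal real part r bounds all moduli.  At the maximizer
    the modulus cannot exceed the real part, so the value itself is r. *)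
Lemma qform_extremal : exists (r : R) (x0 : 'cV[R[i]]_n),
  [/\ 0 <= r, vnorm x0 = 1, qform A x0 = r%:C%C &
      forall x, vnorm x = 1 -> normc (qform A x) <= r].
Proof.
have sphere0 : @unit_sphere R (n + n) !=set0.
  exists (delta_mx 0 (lshift n (Ordinal n_gt0))).
  by rewrite /unit_sphere /= /qf mulmx1 trmx_delta mul_delta_mx mxE eqxx.
have [w0 + w0max] := compact_EVT_max sphere0 (@unit_sphere_compact R (n + n))
  (continuous_subspaceT (@qf_continuous R _ (hat1 S1 S2))).
rewrite inE => w0S; have [x0 x0w] := realify_surj w0.
have x01 : vnorm x0 = 1 by apply/vnorm1P; rewrite x0w.
pose r := complex.Re (qform A x0).
have Re_le x : vnorm x = 1 -> complex.Re (qform A x) <= r.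
  move=> /vnorm1P x1; rewrite /r !(qform_hat _ hS) /= x0w.
  by apply: w0max; rewrite inE.
have norm_le x : vnorm x = 1 -> normc (qform A x) <= r.
  move=> x1; have [c c1 qE] := phase_sqrt (qform A x).
  have := Re_le (c^-1 *: x); rewrite qform_phase.
  rewrite [X in complex.Re (_ * X)]qE mulrA -exprMn.
  have c0 : c != 0.
    apply/eqP => c0; move/eqP: c1.
    by rewrite c0 ComplexField.Normc.normc0 eq_sym oner_eq0.
  rewrite mulVf // expr1n mul1r /=; apply.
  by apply: vnorm_phase => //; rewrite ComplexField.Normc.normcV c1 invr1.
exists r, x0; split => //; first exact: le_trans (normc_ge0 _) (norm_le _ x01).
move: (norm_le _ x01); rewrite /r; case: (qform A x0) => a b /= ab.
have a0 : 0 <= a by apply: le_trans (sqrtr_ge0 _) ab.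
congr Complex; apply/eqP; rewrite -sqrf_eq0 eq_le sqr_ge0 andbT.
have : a ^+ 2 + b ^+ 2 <= a ^+ 2.
  by rewrite -(@ler_sqrt _ _ (a ^+ 2)) ?sqr_ge0 // sqrtr_sqr ger0_norm.
by rewrite gerDl.
Qed.

End ExtremalVector.

Section CircularPseudoRange.
Variables (R : realType) (n : nat) (A : 'M[R[i]]_n) (S1 S2 : 'M[R]_n).

Local Notation normc := ComplexField.Normc.normc.
Local Notation toC := (map_mx (real_complex R)).

Hypothesis S1_sym : S1^T = S1.
Hypothesis S2_sym : S2^T = S2.
Hypothesis hS : 2^-1 *: (A + A^T) = toC S1 + 'i%C *: toC S2.

Variables (r : R) (x0 : 'cV[R[i]]_n).
Hypothesis r_ge0 : 0 <= r.
Hypothesis x0_unit : vnorm x0 = 1.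
Hypothesis qx0 : qform A x0 = r%:C%C.
Hypothesis q_le : forall x, vnorm x = 1 -> normc (qform A x) <= r.

Lemma chull_pseudo_range : chull (pseudo_range A) = disk r.
Proof.
apply: chull_of_circle => // [_ [x x1 <-]|z zr]; first exact: q_le.
have [c c1 zE] := phase_sqrt z; exists (c *: x0); first exact: vnorm_phase.
by rewrite qform_phase qx0 [RHS]zE zr.
Qed.

Lemma pseudo_radiusE : pseudo_radius A = r.
Proof.
apply: maximumE; split => [|_ [x x1 <-]]; last exact: q_le.
by exists x0; rewrite // qx0 normc_real ger0_norm.
Qed.

Lemma hat1_sym : (hat1 S1 S2)^T = hat1 S1 S2.
Proof. by rewrite /hat1 tr_block_mx !linearN /= S1_sym S2_sym. Qed.

Lemma hat2_sym : (hat2 S1 S2)^T = hat2 S1 S2.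
Proof. by rewrite /hat2 tr_block_mx !linearN /= S1_sym S2_sym. Qed.

Let M (t : R[i]) :=
  complex.Re t *: hat1 S1 S2 + complex.Im t *: hat2 S1 S2.

Lemma qf_pencil t x : qf (M t) (realify x) = complex.Re (conjc t * qform A x).
Proof.
by rewrite (qform_hat _ hS) qfD !qfZ; case: t => a b /=; rewrite mulNr opprK.
Qed.

(** Writing t = c^2 |t|, the vectors c x0 and i c x0 give the values r c^2 and
    - r c^2, which have the direction of t and the opposite one, and so attain
    the two ends of the range allowed by the bound |x^T A x| <= r. *)
Lemma pencil_extrema t :
  lambda_max (M t) = normc t * r /\ lambda_min (M t) = - (normc t * r).
Proof.
have Msym : (M t)^T = M t.
  by rewrite linearD /= !linearZ /= hat1_sym hat2_sym.
have normJ : normc (conjc t) = normc t by case: (t) => a b /=; rewrite sqrrN.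
have bound w : unit_sphere w -> `|qf (M t) w| <= normc t * r.
  have [x <-] := realify_surj w; move=> /vnorm1P x1; rewrite qf_pencil.
  apply: le_trans (norm_Re_le_normc _) _.
  by rewrite ComplexField.Normc.normcM normJ ler_wpM2l ?normc_ge0 ?q_le.
have [c c1 tE] := phase_sqrt t.
have tJ : conjc t = conjc c ^+ 2 * (normc t)%:C%C.
  rewrite {1}tE rmorphM rmorphXn; congr (_ * _); exact: conjc_real.
have attained (d : R[i]) (e : R) : normc d = 1 -> d ^+ 2 = e%:C%C ->
    vnorm (d *: (c *: x0)) = 1 /\
    qf (M t) (realify (d *: (c *: x0))) = e * (normc t * r).
  move=> d1 dE; split; first by do 2 apply: vnorm_phase => //.
  rewrite qf_pencil !qform_phase qx0 dE tJ.
  have cJc : conjc c * c = 1.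
    rewrite mulrC -sqr_normc normc_def.
    by move: c1; case: (c) => a b /= ->; rewrite expr1n.
  have -> : conjc c ^+ 2 * (normc t)%:C%C * (e%:C%C * (c ^+ 2 * r%:C%C)) =
    (conjc c * c) ^+ 2 * (e * (normc t * r))%:C%C by rewrite !rmorphM /=; ring.
  by rewrite cJc expr1n mul1r.
have [x1 xmax] := attained 1 1 (ComplexField.Normc.normc1 R) (expr1n _ 2).
have normi : normc 'i%C = 1 :> R by rewrite /= expr0n expr1n add0r sqrtr1.
have [y1 ymin] :=
  attained 'i%C (- 1) normi (etrans (sqr_i R) (esym (rmorphN1 _))).
split.
  apply: (rayleigh_max Msym _ (proj1 (vnorm1P _) x1)); last first.
    by rewrite xmax mul1r.
  by move=> v /bound; rewrite ler_norml => /andP[].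
apply: (rayleigh_min Msym _ (proj1 (vnorm1P _) y1)); last first.
  by rewrite ymin mulN1r.
by move=> v /bound; rewrite ler_norml => /andP[].
Qed.

End CircularPseudoRange.

(** * The theorem *)

Theorem theorem6p3 (R : realType) (n : nat) (n_gt0 : (0 < n)%N)
  (A : 'M[R[i]]_n) (S1 S2 : 'M[R]_n)
  (S1_sym : S1^T = S1) (S2_sym : S2^T = S2)
  (hS : 2^-1 *: (A + A^T) =
        map_mx (real_complex R) S1 + 'i%C *: map_mx (real_complex R) S2) :
  let H1 := hat1 S1 S2 in
  let H2 := hat2 S1 S2 in
  let K := chull (pseudo_range A) in
  [/\ (* the hat matrices are symmetric *)
      H1^T = H1 /\ H2^T = H2,
      (* (a) *)
      ccompact K /\ cconvex K,
      (forall theta : R,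
        let M := cos theta *: H1 + sin theta *: H2 in
        [/\ (forall c : R, supporting_re_line K theta c <->
               c = lambda_min M \/ c = lambda_max M),
            (forall x y : R, K (Complex x y) ->
               lambda_min M <= x * cos theta + y * sin theta <= lambda_max M),
            (exists x y : R, K (Complex x y) /\
               x * cos theta + y * sin theta = lambda_min M)
          & (exists x y : R, K (Complex x y) /\
               x * cos theta + y * sin theta = lambda_max M)])
    & (* (b) *)
      is_max [set lambda_max (t.1 *: H1 + t.2 *: H2)
             | t in [set t : R * R | t.1 ^+ 2 + t.2 ^+ 2 <= 1]]
        (pseudo_radius A) /\
      is_max [set lambda_max (t.1 *: H1 + t.2 *: H2)
             | t in [set t : R * R | t.1 ^+ 2 + t.2 ^+ 2 = 1]]
        (pseudo_radius A)].
Proof.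
move=> H1 H2 K.
have [r [x0 [r0 x01 qx0 q_le]]] := qform_extremal n_gt0 hS.
have KE : K = disk r := chull_pseudo_range r0 x01 qx0 q_le.
have pencil (a b : R) :=
  pencil_extrema S1_sym S2_sym hS x01 qx0 q_le (Complex a b).
split; first by split; [exact: hat1_sym | exact: hat2_sym].
- by rewrite KE; split; [exact: disk_ccompact | exact: disk_cconvex].
- move=> theta M; rewrite KE.
  have [] := pencil (cos theta) (sin theta).
  rewrite [ComplexField.Normc.normc _]normc_cis mul1r /= -/M => -> ->.
  have touch e : `|e| <= r -> exists x y : R,
      disk r (Complex x y) /\ x * cos theta + y * sin theta = e.
    move=> /(disk_directional_attained theta)[[x y] xyr <-].
    by exists x, y; rewrite Re_cisN.
  split; first by move=> c; exact: supporting_disk.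
  + by move=> x y /(disk_directional_bound theta); rewrite Re_cisN.
  + by apply: touch; rewrite normrN ger0_norm.
  + by apply: touch; rewrite ger0_norm.
- rewrite (pseudo_radiusE r0 x01 qx0 q_le).
  have unit_direction : lambda_max (1 *: H1 + 0 *: H2) = r.
    have [+ _] := pencil 1 0.
    by rewrite [ComplexField.Normc.normc _]ComplexField.Normc.normc1 mul1r.
  have upper (t : R * R) : t.1 ^+ 2 + t.2 ^+ 2 <= 1 ->
      lambda_max (t.1 *: H1 + t.2 *: H2) <= r.
    move=> t1; have [/= -> _] := pencil t.1 t.2.
    by rewrite ler_piMl // -sqrtr1 ler_wsqrtr.
  split; split.
  + by exists (1, 0) => //=; rewrite expr1n expr0n addr0.
  + by move=> _ [t t1 <-]; apply: upper.
  + by exists (1, 0) => //=; rewrite expr1n expr0n addr0.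
  + by move=> _ [t t1 <-]; apply: upper; rewrite t1.
Qed.
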